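(* Let $q$ be a prime power and let $a,b\ge0$ be integers. Then $$g_{(q-1)\cdot q^a+(q-2)\cdot q^b,\,q}=-(S_b-S_a)^{q-2}.$$
   Context: For a prime power $q$ (a power of the prime $p$) and an integer $n\ge 0$, $g_{n,q}\in\mathbb{F}_p[X]$ denotes the unique polynomial satisfying $\sum_{a\in\mathbb{F}_q}(X+a)^n=g_{n,q}(X^q-X)$. For fixed $q$, $S_0=0$ and $S_k=X+X^q+X^{q^2}+\cdots+X^{q^{k-1}}$ for $k\ge1$. A zeroth power of a polynomial (including the zero polynomial) is $1$. *)

(* Defs.v *)
From mathcomp Require Import all_boot all_algebra finfield zify.
Set Implicit Arguments.
Unset Strict Implicit.
Unset Printing Implicit Defensive.
Import GRing.Theory.
Local Open Scope ring_scope.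

Section ReversedDickson.

Variables (p : nat) (F0 : finFieldType) (charF : p \in [pchar F0]).

(* The same field as F0, seen as an 'F_p-algebra: [in_alg F] is the inclusion
   of 'F_p into F. *)
Local Notation F := (pPrimeCharType charF).

Definition defines_g (n : nat) (g : {poly 'F_p}) : bool :=
  \sum_(a : F) ('X + a%:P) ^+ n
    == map_poly (in_alg F) g \Po ('X^#|F0| - 'X) :> {poly F}.

Let q := #|F0|.

Let q_gt1 : (1 < q)%N. Proof. exact: finNzRing_gt1. Qed.

Let natq0 : q%:R = 0 :> F.
Proof.
rewrite /q (card_pprimeChar charF).
have : (1 < p ^ logn p #|F0|)%N by rewrite -(card_pprimeChar charF); exact: q_gt1.
case: (logn _ _) => [|k _]; first by rewrite expn0.
by rewrite expnS natrM (pcharf0 charF) mul0r.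
Qed.

Let size_XqX : size ('X^q - 'X : {poly F}) = q.+1.
Proof. by rewrite size_polyDl size_polyXn // size_polyN size_polyX ltnS. Qed.

Lemma sum_expf_small j : (j < q.-1)%N -> \sum_(a : F) a ^+ j = 0.
Proof.
case: j => [|j] ltj.
  rewrite (eq_bigr (fun=> 1)) => [|a _]; last by rewrite expr0.
  by rewrite sumr_const; exact: natq0.
have [c c0 cj] : exists2 c : F, c != 0 & c ^+ j.+1 != 1.
  apply/exists_inP; apply: contraLR ltj; rewrite -leqNgt => /exists_inPn all1.
  pose P : {poly F} := 'X^(j.+1) - 1%:P.
  have sP : size P = j.+2 by rewrite size_XnsubC.
  have P0 : P != 0 by rewrite -size_poly_gt0 sP.
  have rs : all (root P) (enum (predC1 (0 : F))).
    apply/allP => x; rewrite mem_enum => x0.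
    by rewrite rootE !hornerE subr_eq0 -[_ == _]negbK all1.
  have := max_poly_roots P0 rs (enum_uniq _).
  by rewrite sP -cardE cardC1 ltnS.
apply/eqP; move: cj; apply: contraR => S0.
rewrite -(inj_eq (mulIf S0)) mul1r mulr_sumr.
rewrite [eqbRHS](reindex_inj (mulfI c0)) /=; apply/eqP/eq_bigr => a _.
by rewrite exprMn.
Qed.

Lemma sum_expf_pred : \sum_(a : F) a ^+ q.-1 = -1.
Proof.
rewrite (bigD1 0) //= expr0n -subn1 subn_eq0 leqNgt q_gt1 /= add0r subn1.
rewrite (eq_bigr (fun=> 1)) => [|a a0]; last first.
  apply: (mulfI a0); rewrite -exprS prednK ?(ltnW q_gt1) // mulr1.
  exact: (expf_card (a : F0)).
rewrite sumr_const cardC1; apply/eqP; rewrite -subr_eq0 opprK -mulrSr.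
by rewrite prednK ?(ltnW q_gt1) //; exact/eqP/natq0.
Qed.

Let XDa_expq (a : F) : ('X + a%:P) ^+ q = 'X^q + a%:P.
Proof.
rewrite exprDn_pchar.
  by rewrite -polyC_exp; congr (_ + _%:P); exact: (expf_card (a : F0)).
have chP : p \in [pchar {poly F}] by rewrite pchar_poly.
rewrite (eq_pnat _ (pcharf_eq chP)) /q (card_pprimeChar charF).
by rewrite pnatX pnat_id // (pcharf_prime charF).
Qed.

(* The roots Y = X + a of Y^q - Y = X^q - X give a Newton recurrence. *)
Lemma defines_g_ex n : exists g, defines_g n g.
Proof.
elim/ltn_ind: n => n IHn; have [ltnq | leqn] := ltnP n q; last first.
  have lt1 : ((n - q).+1 < n)%N by lia.
  have lt0 : (n - q < n)%N by lia.
  have [g1 /eqP Eg1] := IHn _ lt1; have [g0 /eqP Eg0] := IHn _ lt0.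
  exists (g1 + 'X * g0); rewrite /defines_g rmorphD rmorphM /= map_polyX.
  rewrite comp_polyD comp_polyM comp_polyX -Eg1 -Eg0 mulr_sumr -big_split /=.
  apply/eqP/eq_bigr => a _; rewrite -{1}(subnK leqn) exprD exprS mulrC -mulrDl.
  by rewrite XDa_expq; congr (_ * _); rewrite [RHS]addrC addrA subrK.
have sum_bin : \sum_(a : F) ('X + a%:P) ^+ n
    = \sum_(i < n.+1) ('X^(n - i) * (\sum_(a : F) a ^+ i)%:P) *+ 'C(n, i).
  under eq_bigr => a _ do rewrite exprDn.
  rewrite exchange_big /=; apply: eq_bigr => i _.
  rewrite sumrMnl rmorph_sum mulr_sumr; congr (_ *+ _).
  by apply: eq_bigr => a _; rewrite rmorphXn.
have sum_low m : (m <= q.-1)%N ->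
    \sum_(i < m) ('X^(n - i) * (\sum_(a : F) a ^+ i)%:P) *+ 'C(n, i) = 0.
  move=> le_m; rewrite big1 // => i _.
  by rewrite sum_expf_small ?mulr0 ?mul0rn // (leq_trans (ltn_ord i)).
have [nq1 | ltn1] : n = q.-1 \/ (n < q.-1)%N by lia.
  exists (- 1); rewrite /defines_g rmorphN rmorph1 raddfN /= comp_polyC.
  rewrite sum_bin big_ord_recr /= sum_low ?nq1 // sum_expf_pred.
  by rewrite subnn binn add0r expr0 mul1r mulr1n rmorphN.
exists 0; rewrite /defines_g rmorph0 comp_poly0 sum_bin sum_low //.
Qed.

Definition reversed_dickson (n : nat) : {poly 'F_p} := xchoose (defines_g_ex n).

Lemma reversed_dicksonP n : defines_g n (reversed_dickson n).
Proof. exact: xchooseP. Qed.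

Lemma reversed_dickson_unique n g : defines_g n g -> g = reversed_dickson n.
Proof.
move=> /eqP dg; have /eqP := reversed_dicksonP n; rewrite dg => /eqP.
rewrite -subr_eq0 -comp_polyB -rmorphB comp_poly_eq0 ?size_XqX ?ltnS ?(ltnW q_gt1) //.
by rewrite map_poly_eq0 subr_eq0 => /eqP.
Qed.

End ReversedDickson.

Definition S_poly (p q k : nat) : {poly 'F_p} := \sum_(i < k) 'X^(q ^ i)%N.

(* Main.v *)
(* Put W = X^q - X.  Then S_k(W) = X^(q^k) - X telescopes, and the claim becomes
   \sum_c (A + c)^(q-1) (B + c)^(q-2) = - (B - A)^(q-2) at A = X^(q^a) and
   B = X^(q^b).  For A = - s with s in F_q the first factor is the indicator of
   c != s, and \sum_c (B + c)^(q-2) = 0 because q - 2 < q - 1.  Both sides have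
   degree < q in A and agree at the q points - s, so they agree for every A. *)
Require Import Defs.
From mathcomp Require Import all_boot all_algebra finfield.
Import GRing.Theory.
Local Open Scope ring_scope.

Section PowerSums.

Variables (p : nat) (F0 : finFieldType) (charF : p \in [pchar F0]).

Local Notation F := (pPrimeCharType charF).
Local Notation q := #|F0|.

Let q_gt1 : (1 < q)%N. Proof. exact: finNzRing_gt1. Qed.

Let predq_gt0 : (0 < q.-1)%N. Proof. by rewrite -subn1 subn_gt0. Qed.

(** In the binomial expansion the inner sums are power sums over [F] with exponents at most [j], all
    zero below [q - 1]. *)
Lemma sum_expD_small (R : comNzRingType) (f : {rmorphism F -> R}) (B : R) j :
  (j < q.-1)%N -> \sum_(c : F) (B + f c) ^+ j = 0.
Proof.
move=> ltj; under eq_bigr => c _ do rewrite exprDn.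
rewrite exchange_big big1 //= => i _.
rewrite sumrMnl -mulr_sumr; under eq_bigr => c _ do rewrite -rmorphXn.
rewrite -rmorph_sum (@sum_expf_small p F0 charF); first by rewrite rmorph0 mulr0 mul0rn.
exact: leq_ltn_trans (leq_ord i) ltj.
Qed.

Lemma expf_pred_card (x : F) : x ^+ q.-1 = (x != 0)%:R.
Proof.
have [-> | x0] := eqVneq x 0.
  by rewrite expr0n eqn0Ngt predq_gt0.
apply: (mulfI x0); rewrite -exprS prednK ?(ltnW q_gt1) // mulr1.
exact: (expf_card (x : F0)).
Qed.

Lemma sum_expD_pred_expD (R : idomainType) (f : {rmorphism F -> R}) (A B : R) :
  \sum_(c : F) (A + f c) ^+ q.-1 * (B + f c) ^+ q.-2 = - (B - A) ^+ q.-2.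
Proof.
(* [G] is the difference of the two sides, with [A] replaced by an indeterminate. *)
pose G : {poly R} := \sum_(c : F) ((B + f c) ^+ q.-2)%:P * ('X + (f c)%:P) ^+ q.-1
  + (B%:P - 'X) ^+ q.-2.
suff G0 : G = 0.
  apply/eqP; rewrite -subr_eq0 opprK; apply/eqP.
  have := congr1 (horner^~ A) G0; rewrite /G !hornerE horner_sum; apply: etrans.
  by congr (_ + _); apply: eq_bigr => c _; rewrite !hornerE mulrC.
pose rs := [seq - f s | s <- enum F].
(* Every summand of [G] has degree at most [q - 1], while [rs] lists [q] points. *)
have szG : (size G <= size rs)%N.
  rewrite size_map -cardE; apply: leq_trans (size_polyD _ _) _.
  rewrite geq_max; apply/andP; split.
    apply: leq_trans (size_sum _ _ _) _; apply/bigmax_leqP => c _.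
    rewrite mul_polyC; apply: leq_trans (size_scale_leq _ _) _.
    by rewrite -[f c]opprK polyCN size_exp_XsubC prednK // ltnW.
  rewrite -opprB -[- _]mulN1r exprMn -signr_odd.
  rewrite -(rmorph_sign polyC) mul_polyC; apply: leq_trans (size_scale_leq _ _) _.
  by rewrite size_exp_XsubC prednK // leq_pred.
have uniq_rs : uniq rs.
  by rewrite map_inj_uniq ?enum_uniq // => x y /oppr_inj/fmorph_inj.
have roots : all (root G) rs.
  apply/allP => _ /mapP[s _ ->]; rewrite rootE /G !hornerE horner_sum opprK.
  (* The term [c = s] vanishes because [q - 1 > 0]. The last summand of [G] at [- f s] is
     [(B + f s) ^+ q.-2], which fills this gap and completes the sum to one over all of [F]. *)
  rewrite (bigD1 s) //= !hornerE -rmorphN -rmorphD addNr rmorph0.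
  rewrite [0 ^+ _]expr0n eqn0Ngt predq_gt0 mulr0 add0r addrC.
  rewrite (eq_bigr (fun c => (B + f c) ^+ q.-2)) => [|c cs].
    have := @sum_expD_small R f B q.-2.
    by rewrite prednK // leqnn (bigD1 s) //= => ->.
  rewrite !hornerE -rmorphD -rmorphXn expf_pred_card (addrC (- s)) subr_eq0 cs.
  by rewrite rmorph1 mulr1.
by apply: contraTeq szG => G0; rewrite -ltnNge; apply: max_poly_roots.
Qed.

(** This makes raising to the power [q ^ k] additive on [{poly F}]. *)
Lemma pnat_card_exp k : [pchar {poly F}].-nat (q ^ k)%N.
Proof.
have chP : p \in [pchar {poly F}] by rewrite pchar_poly.
rewrite (eq_pnat _ (pcharf_eq chP)) (card_pprimeChar charF).
by rewrite !pnatX pnat_id // (pcharf_prime charF).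
Qed.

Lemma expf_card_exp k (c : F) : c ^+ (q ^ k)%N = c.
Proof.
elim: k => [|k IHk]; first by rewrite expr1.
by rewrite expnSr exprM IHk; apply: (expf_card (c : F0)).
Qed.

Lemma polyXDC_exp_card_exp k (c : F) :
  ('X + c%:P) ^+ (q ^ k)%N = 'X^(q ^ k)%N + c%:P.
Proof. by rewrite exprDn_pchar ?pnat_card_exp // -polyC_exp expf_card_exp. Qed.

Lemma S_poly_comp k :
  map_poly (in_alg F) (S_poly p q k) \Po ('X^q - 'X) = 'X^(q ^ k)%N - 'X.
Proof.
rewrite /S_poly !rmorph_sum /=.
(* By that additivity, the [q ^ i]-th power of ['X^q - 'X] is a difference of consecutive terms. *)
rewrite (eq_bigr (fun i : 'I_k => 'X^(q ^ i.+1)%N - 'X^(q ^ i)%N)) => [|i _].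
  by rewrite -(big_mkord xpredT (fun i => 'X^(q ^ i.+1)%N - 'X^(q ^ i)%N)) telescope_sumr.
rewrite map_polyXn comp_Xn_poly exprDn_pchar ?exprNn_pchar ?pnat_card_exp //.
by rewrite -exprM -expnS.
Qed.

End PowerSums.

Theorem lemma2p5 (p q : nat) (F : finFieldType) (charF : p \in [pchar F])
    (cardF : #|F| = q) (a b : nat) :
  reversed_dickson charF ((q - 1) * q ^ a + (q - 2) * q ^ b)%N
    = - (S_poly p q b - S_poly p q a) ^+ (q - 2)%N.
Proof.
(* By uniqueness it suffices to check the defining identity for the right-hand side. *)
subst q; apply/esym/reversed_dickson_unique/eqP.
rewrite rmorphN rmorphXn rmorphB raddfN /= rmorphXn /= comp_polyB !S_poly_comp.
rewrite opprB addrA subrK subn1 subn2 -(@sum_expD_pred_expD p F charF _ polyC).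
(* The power of ['X + c%:P] splits into a [(q - 1)]-th power of ['X^(q ^ a) + c%:P] and a
   [(q - 2)]-th power of ['X^(q ^ b) + c%:P]. *)
apply: eq_bigr => c _; rewrite exprD ![(_ * #|F| ^ _)%N]mulnC !exprM.
by rewrite !polyXDC_exp_card_exp.
Qed.
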